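(* Let $(A,\Phi)$ be an $\ell$EAS over a field $\mathbb{K}$. (1) If $a\in A$ is a special vector of eigenvalue $1$ of $(A,\Phi)$, i.e. $\Phi(a\otimes a)=a\otimes a$, then the map $\Delta_a\colon A\longrightarrow A\otimes A$ defined by $\Delta_a(b)=\Phi(b\otimes a)$ is a coassociative coproduct. (2) If $\varepsilon\in A^*$ satisfies $(\varepsilon\otimes\varepsilon)\circ\Phi=\varepsilon\otimes\varepsilon$ (i.e. $\varepsilon$ is a special vector of eigenvalue $1$ of $(A,\Phi)^*$), then the map $m_\varepsilon\colon A\otimes A\longrightarrow A$ defined by $m_\varepsilon=(\mathrm{Id}\otimes\varepsilon)\circ\Phi$ is an associative product. (3) If $a\in A$ is a left unit of $(A,\Phi)$ and $\varepsilon\in A^*$ is a left counit of $(A,\Phi)$ such that $\varepsilon(a)=1$, then $(A,m_\varepsilon,\Delta_a)$ is a bialgebra, with $a$ as a left unit and $\varepsilon$ as a left counit. Moreover, $(A,\Phi)=\ell\mathbf{EAS}(A,m_\varepsilon,\Delta_a)$.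
   Context: $\mathbb{K}$ is a commutative field, all vector spaces are over $\mathbb{K}$, and $\tau(x\otimes y)=y\otimes x$. A linear extended associative semigroup ($\ell$EAS) is a pair $(A,\Phi)$ where $A$ is a vector space and $\Phi\colon A\otimes A\to A\otimes A$ is a linear map with \[(\mathrm{Id}\otimes\Phi)\circ(\Phi\otimes\mathrm{Id})\circ(\mathrm{Id}\otimes\Phi)=(\Phi\otimes\mathrm{Id})\circ(\mathrm{Id}\otimes\tau)\circ(\Phi\otimes\mathrm{Id}).\] An element $a\in A$ is a left unit of $(A,\Phi)$ if $\Phi(a\otimes b)=b\otimes a$ for every $b\in A$. A linear form $f\in A^*$ is a left counit of $(A,\Phi)$ if $(f\otimes\mathrm{Id})\circ\Phi=\mathrm{Id}\otimes f$, i.e. $(f\otimes \mathrm{Id})\circ\Phi(a\otimes b)=f(b)a$ for all $a,b \in A$. Here a bialgebra $(A,m,\Delta)$ is not necessarily unitary nor counitary: $m$ is an associative product, $\Delta$ a coassociative coproduct, and $\Delta$ is multiplicative, $\Delta(xy)=\Delta(x)\Delta(y)$. A left unit of $m$ is an element $a$ with $m(a\otimes b)=b$ for all $b$; a left counit of $\Delta$ is a linear form $\varepsilon$ with $(\varepsilon\otimes\mathrm{Id})\circ\Delta=\mathrm{Id}$. For such a bialgebra, $\ell\mathbf{EAS}(A,m,\Delta)$ denotes the pair $(A,\Psi)$ with $\Psi(a\otimes b)=\sum a^{(1)}b\otimes a^{(2)}$, where $\Delta(a)=\sum a^{(1)}\otimes a^{(2)}$. *)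

(* Defs.v *)
From HB Require Import structures.
From mathcomp Require Import all_boot all_algebra.
From mathcomp Require Import generic_quotient ring_quotient sesquilinear.
From mathcomp Require Import boolp.
From mathcomp Require Import freeg.

Set Implicit Arguments.
Unset Strict Implicit.
Unset Printing Implicit Defensive.

Import GRing.Theory.
Local Open Scope ring_scope.
Local Open Scope quotient_scope.

(* The tensor product of two vector spaces A and B of arbitrary dimension: the
   quotient of the free vector space on A * B by the subspace spanned by the
   bilinearity relations. *)
Section TensorProduct.
Variables (K : fieldType) (A B : lmodType K).

Local Notation F := {freeg (A * B)%type / K}.
Local Notation gen x y := (<< (x, y) >> : F).

Inductive tens_null : F -> Prop :=
| tens_null0 : tens_null 0
| tens_nullD u v : tens_null u -> tens_null v -> tens_null (u + v)
| tens_nullZ k u : tens_null u -> tens_null (k *: u)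
| tens_nullPl k x x' y :
    tens_null (gen (k *: x + x') y - (k *: gen x y + gen x' y))
| tens_nullPr k x y y' :
    tens_null (gen x (k *: y + y') - (k *: gen x y + gen x y')).

Definition tens_rel : {pred F} := [pred u | `[< tens_null u >]].

Lemma tens_relP u : reflect (tens_null u) (u \in tens_rel).
Proof. exact: asboolP. Qed.

Lemma tens_rel_zmod : zmod_closed tens_rel.
Proof.
split; first exact/tens_relP/tens_null0.
move=> u v /tens_relP hu /tens_relP hv; apply/tens_relP.
by rewrite -scaleN1r; apply: tens_nullD => //; apply: tens_nullZ.
Qed.

HB.instance Definition _ := GRing.isZmodClosed.Build F tens_rel tens_rel_zmod.

Definition tens := Quotient.quot tens_rel.

HB.instance Definition _ := GRing.Zmodule.on tens.

Definition tens_pi (u : F) : tens := \pi_(Quotient.quot tens_rel) u.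

Definition tens_repr (u : tens) : F := repr (u : Quotient.quot tens_rel).

Lemma tens_reprK u : tens_pi (tens_repr u) = u.
Proof. exact: reprK. Qed.

Lemma tens_pi_additive : additive tens_pi.
Proof. by move=> u v; rewrite /tens_pi raddfB. Qed.

HB.instance Definition _ := GRing.isZmodMorphism.Build F tens tens_pi
  tens_pi_additive.

Lemma tens_piP (u v : F) : reflect (tens_null (u - v)) (tens_pi u == tens_pi v).
Proof. by rewrite /tens_pi -Quotient.idealrBE; apply: tens_relP. Qed.

Definition tens_scale (k : K) (u : tens) : tens := tens_pi (k *: tens_repr u).

Lemma tens_scaleE k u : tens_scale k (tens_pi u) = tens_pi (k *: u).
Proof.
by apply/eqP/tens_piP; rewrite -scalerBr; apply/tens_nullZ/tens_piP;
  rewrite tens_reprK.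
Qed.

Lemma tens_scaleA k l u : tens_scale k (tens_scale l u) = tens_scale (k * l) u.
Proof. by rewrite -[u]tens_reprK !tens_scaleE scalerA. Qed.

Lemma tens_scale1 : left_id 1 tens_scale.
Proof. by move=> u; rewrite -[u]tens_reprK tens_scaleE scale1r. Qed.

Lemma tens_scaleDr : right_distributive tens_scale +%R.
Proof.
move=> k u v; rewrite -[u]tens_reprK -[v]tens_reprK -raddfD !tens_scaleE.
by rewrite scalerDr raddfD.
Qed.

Lemma tens_scaleDl u : {morph tens_scale^~ u : k l / k + l}.
Proof. by move=> k l; rewrite -[u]tens_reprK !tens_scaleE scalerDl raddfD. Qed.

HB.instance Definition _ := GRing.Zmodule_isLmodule.Build K tens
  tens_scaleA tens_scale1 tens_scaleDr tens_scaleDl.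

Lemma tens_pi_scalable : scalable tens_pi.
Proof. by move=> k u; rewrite -tens_scaleE. Qed.

HB.instance Definition _ := GRing.isScalable.Build K F tens *:%R tens_pi
  tens_pi_scalable.

Definition tpure (x : A) (y : B) : tens := tens_pi (gen x y).

End TensorProduct.

Arguments tpure {K A B} x y.

Notation "A ⊗ B" := (tens A B) (at level 40, left associativity).
Notation "x ⊗v y" := (tpure x y) (at level 40, left associativity).

Section TensorTheory.
Variables (K : fieldType) (A B : lmodType K).

Lemma tpure_bilinear : bilinear_for *:%R *:%R (@tpure K A B).
Proof.
have E k (u v w : {freeg (A * B)%type / K}) : tens_null (u - (k *: v + w)) ->
    tens_pi u = k *: tens_pi v + tens_pi w.
  by move=> /tens_piP/eqP ->; rewrite linearP.
by split=> [y k x x' | x k y y'] /=; apply: E;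
  [apply: tens_nullPl | apply: tens_nullPr].
Qed.

HB.instance Definition _ := bilinear_isBilinear.Build K A B (tens A B)
  *:%R *:%R (@tpure K A B) tpure_bilinear.

HB.instance Definition _ (x : A) := GRing.isLinear.Build K B (tens A B) *:%R
  (tpure x) (tpure_bilinear.2 x).

Lemma fglift_linear (M : lmodType K) (G : choiceType) (f : G -> M) :
  linear (fglift f : {freeg G / K} -> M).
Proof.
have fB : {morph (fglift f : {freeg G / K} -> M) : u v / u - v}.
  exact: lift_is_additive.
have f0 : fglift f (0 : {freeg G / K}) = 0 by rewrite -(subrr 0) fB subrr.
have fN : {morph (fglift f : {freeg G / K} -> M) : v / - v}.
  by move=> v; rewrite -sub0r fB f0 sub0r.
have fD : {morph (fglift f : {freeg G / K} -> M) : u v / u + v}.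
  by move=> u v; rewrite -[v in LHS]opprK fB fN opprK.
have fU c d z : fglift f (c *: << d *g z >> : {freeg G / K}) = (c * d) *: f z.
  have -> : c *: << d *g z >> = << (c * d) *g z >> :> {freeg G / K}.
    by apply/eqP/freeg_eqP => y; rewrite coeffZ !coeffU mulrA.
  by rewrite liftU.
move=> k u v; rewrite fD; congr (_ + _).
elim/freeg_ind_dom0: u => [|c x u _ _ IH]; first by rewrite scaler0 f0 scaler0.
by rewrite scalerDr !fD IH scalerDr fU liftU scalerA.
Qed.

Lemma tens_ind (P : tens A B -> Prop) :
  (forall k x y u, P u -> P (k *: (x ⊗v y) + u)) -> P 0 -> forall u, P u.
Proof.
move=> PS P0 u; rewrite -[u]tens_reprK.
elim/freeg_ind_dom0: (tens_repr u) => [|k [x y] v _ _ IH].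
  by rewrite raddf0.
have -> : << k *g (x, y) >> = k *: << (x, y) >> :> {freeg (A * B)%type / K}.
  by apply/eqP/freeg_eqP => z; rewrite coeffZ !coeffU mul1r.
by rewrite linearP; apply: PS.
Qed.

Lemma tens_ext (M : lmodType K) (f g : {linear tens A B -> M}) :
  (forall x y, f (x ⊗v y) = g (x ⊗v y)) -> f =1 g.
Proof.
move=> fg; elim/tens_ind => [k x y u IH|]; last by rewrite !linear0.
by rewrite !linearP fg IH.
Qed.

(* The linear map induced by f : A -> B -> M; meaningful when f is bilinear. *)
Definition tens_lift (M : lmodType K) (f : A -> B -> M) (u : tens A B) : M :=
  fglift (fun z => f z.1 z.2) (tens_repr u).

Variables (M : lmodType K) (f : A -> B -> M).
Hypothesis f_bilin : bilinear_for *:%R *:%R f.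

Local Notation fl := (fglift (fun z => f z.1 z.2) : {freeg (A * B)%type / K} -> M).
HB.instance Definition _ := GRing.isLinear.Build K _ _ _ fl (fglift_linear _).

Lemma tens_lift_pi (u : {freeg (A * B)%type / K}) :
  tens_lift f (tens_pi u) = fl u.
Proof.
have H v : tens_null v -> fl v = 0.
  elim=> [|{}u {}v _ Hu _ Hv|k {}u _ Hu|k x x' y|k x y y'].
  - by rewrite linear0.
  - by rewrite linearD /= Hu Hv addr0.
  - by rewrite linearZ /= Hu scaler0.
  - rewrite linearB linearP /= !liftU !scale1r /=.
    by have /= -> := f_bilin.1 y k x x'; rewrite subrr.
  - rewrite linearB linearP /= !liftU !scale1r /=.
    by have /= -> := f_bilin.2 x k y y'; rewrite subrr.
apply/eqP; rewrite /tens_lift -subr_eq0 -linearB; apply/eqP/H/tens_piP.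
by rewrite tens_reprK.
Qed.

Lemma tens_liftE x y : tens_lift f (x ⊗v y) = f x y.
Proof. by rewrite tens_lift_pi liftU scale1r. Qed.

Lemma tens_lift_linear : linear (tens_lift f).
Proof.
move=> k u v; rewrite -[u]tens_reprK -[v]tens_reprK -linearP !tens_lift_pi.
exact: linearP.
Qed.

End TensorTheory.

Section TensorMaps.
Variable K : fieldType.
Implicit Types A B C D : lmodType K.

Definition tmap A B C D (f : A -> C) (g : B -> D) : A ⊗ B -> C ⊗ D :=
  tens_lift (fun x y => f x ⊗v g y).

Lemma tmap_bilinear A B C D (f : {linear A -> C}) (g : {linear B -> D}) :
  bilinear_for *:%R *:%R (fun x y => f x ⊗v g y).
Proof. by split=> [y k x x'|x k y y'] /=; rewrite linearP ?linearPl ?linearPr. Qed.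

HB.instance Definition _ A B C D (f : {linear A -> C}) (g : {linear B -> D}) :=
  GRing.isLinear.Build K (A ⊗ B) (C ⊗ D) *:%R (tmap f g)
    (tens_lift_linear (tmap_bilinear f g)).

Lemma tmapE A B C D (f : {linear A -> C}) (g : {linear B -> D}) x y :
  tmap f g (x ⊗v y) = f x ⊗v g y.
Proof. exact: tens_liftE (tmap_bilinear f g) x y. Qed.

Lemma tmapP A B C D (f : {linear A -> C}) (g : {linear B -> D}) k u v :
  tmap f g (k *: u + v) = k *: tmap f g u + tmap f g v.
Proof. exact: linearP. Qed.

Definition tflip A B : A ⊗ B -> B ⊗ A := tens_lift (fun x y => y ⊗v x).

Lemma tflip_bilinear A B :
  bilinear_for *:%R *:%R (fun (x : A) (y : B) => y ⊗v x).
Proof. by split=> [y k x x'|x k y y'] /=; rewrite ?linearPl ?linearPr. Qed.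

HB.instance Definition _ A B := GRing.isLinear.Build K (A ⊗ B) (B ⊗ A) *:%R
  (@tflip A B) (tens_lift_linear (@tflip_bilinear A B)).

Lemma tflipE A B (x : A) (y : B) : tflip (x ⊗v y) = y ⊗v x.
Proof. exact: tens_liftE (@tflip_bilinear A B) x y. Qed.

(* The associativity isomorphism and its inverse. *)
Definition tassoc A B C : (A ⊗ B) ⊗ C -> A ⊗ (B ⊗ C) :=
  tens_lift (fun u z => tmap idfun (applyr tpure z) u).

Definition tassocV A B C : A ⊗ (B ⊗ C) -> (A ⊗ B) ⊗ C :=
  tens_lift (fun x v => tmap (tpure x) idfun v).

Lemma tassoc_bilinear A B C : bilinear_for *:%R *:%R
  (fun (u : A ⊗ B) (z : C) => tmap (@idfun A) (applyr tpure z) u).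
Proof.
split=> [z k u u'|u k z z'] /=; first exact: tmapP.
elim/tens_ind: u => [l x y u IH|]; last by rewrite !linear0 addr0.
rewrite !tmapP IH !tmapE /= linearPr linearPr !scalerDr !scalerA -!addrA.
by rewrite mulrC; congr (_ + _); rewrite addrCA.
Qed.

Lemma tassocV_bilinear A B C : bilinear_for *:%R *:%R
  (fun (x : A) (v : B ⊗ C) => tmap (tpure x) (@idfun C) v).
Proof.
split=> [v k x x'|x k v v'] /=; last exact: tmapP.
elim/tens_ind: v => [l y z v IH|]; last by rewrite !linear0 addr0.
rewrite !tmapP IH !tmapE /= linearPl linearPl !scalerDr !scalerA -!addrA.
by rewrite mulrC; congr (_ + _); rewrite addrCA.
Qed.

HB.instance Definition _ A B C :=
  GRing.isLinear.Build K ((A ⊗ B) ⊗ C) (A ⊗ (B ⊗ C)) *:%R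
  (@tassoc A B C) (tens_lift_linear (@tassoc_bilinear A B C)).

HB.instance Definition _ A B C :=
  GRing.isLinear.Build K (A ⊗ (B ⊗ C)) ((A ⊗ B) ⊗ C) *:%R
  (@tassocV A B C) (tens_lift_linear (@tassocV_bilinear A B C)).

Lemma tassocE A B C (x : A) (y : B) (z : C) :
  tassoc (x ⊗v y ⊗v z) = x ⊗v (y ⊗v z).
Proof. by rewrite /tassoc (tens_liftE (@tassoc_bilinear A B C)) tmapE. Qed.

Lemma tassocVE A B C (x : A) (y : B) (z : C) :
  tassocV (x ⊗v (y ⊗v z)) = x ⊗v y ⊗v z.
Proof. by rewrite /tassocV (tens_liftE (@tassocV_bilinear A B C)) tmapE. Qed.

Lemma tassocK A B C : cancel (@tassoc A B C) (@tassocV A B C).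
Proof.
apply: (@tens_ext _ _ _ _ (@tassocV A B C \o @tassoc A B C) idfun) => u z /=.
elim/tens_ind: u => [k x y u IH|].
  by rewrite linearPl /= linearP linearP /= tassocE tassocVE IH.
by rewrite linear0l !linear0.
Qed.

Lemma tassocVK A B C : cancel (@tassocV A B C) (@tassoc A B C).
Proof.
apply: (@tens_ext _ _ _ _ (@tassoc A B C \o @tassocV A B C) idfun) => x v /=.
elim/tens_ind: v => [k y z v IH|].
  by rewrite linearPr /= linearP linearP /= tassocVE tassocE IH.
by rewrite linear0r !linear0.
Qed.

(* The identifications K ⊗ A = A and A ⊗ K = A. *)
Definition tlunit A : K^o ⊗ A -> A := tens_lift (fun (k : K^o) x => k *: x).

Definition trunit A : A ⊗ K^o -> A := tens_lift (fun x (k : K^o) => k *: x).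

Lemma tlunit_bilinear A :
  bilinear_for *:%R *:%R (fun (k : K^o) (x : A) => (k : K) *: x).
Proof.
split=> [x k l l'|k l x x'] /=; first by rewrite scalerDl scalerA.
by rewrite scalerDr !scalerA mulrC.
Qed.

Lemma trunit_bilinear A :
  bilinear_for *:%R *:%R (fun (x : A) (k : K^o) => (k : K) *: x).
Proof.
split=> [k l x x'|x k l l'] /=; last by rewrite scalerDl scalerA.
by rewrite scalerDr !scalerA mulrC.
Qed.

HB.instance Definition _ A := GRing.isLinear.Build K (K^o ⊗ A) A *:%R
  (@tlunit A) (tens_lift_linear (@tlunit_bilinear A)).

HB.instance Definition _ A := GRing.isLinear.Build K (A ⊗ K^o) A *:%R
  (@trunit A) (tens_lift_linear (@trunit_bilinear A)).

Lemma tlunitE A (k : K^o) (x : A) : tlunit (k ⊗v x) = (k : K) *: x.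
Proof. exact: tens_liftE (@tlunit_bilinear A) k x. Qed.

Lemma trunitE A (k : K^o) (x : A) : trunit (x ⊗v k) = (k : K) *: x.
Proof. exact: tens_liftE (@trunit_bilinear A) x k. Qed.

End TensorMaps.

Notation "f ⊗f g" := (tmap f g) (at level 40, left associativity).

Section LinearEAS.
Variables (K : fieldType) (A : lmodType K).
Implicit Types (Phi : {linear A ⊗ A -> A ⊗ A}) (a : A).
Implicit Types (m : {linear A ⊗ A -> A}) (Delta : {linear A -> A ⊗ A}).
Implicit Type eps : {linear A -> K^o}.

Local Notation Id := (@idfun A).
Local Notation tau := (@tflip K A A).
Local Notation assoc := (@tassoc K A A A).
Local Notation assocV := (@tassocV K A A A).

(* f ⊗ Id and Id ⊗ f as endomorphisms of A ⊗ A ⊗ A, which is represented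
   throughout by A ⊗ (A ⊗ A). *)
Definition onleft (f : A ⊗ A -> A ⊗ A) : A ⊗ (A ⊗ A) -> A ⊗ (A ⊗ A) :=
  assoc \o (f ⊗f Id) \o assocV.

Definition onright (f : A ⊗ A -> A ⊗ A) : A ⊗ (A ⊗ A) -> A ⊗ (A ⊗ A) :=
  Id ⊗f f.

HB.instance Definition _ Phi := GRing.Linear.copy (onleft Phi)
  (assoc \o (Phi ⊗f Id) \o assocV).
HB.instance Definition _ Phi := GRing.Linear.copy (onright Phi) (Id ⊗f Phi).

Definition is_lEAS Phi : Prop :=
  onright Phi \o onleft Phi \o onright Phi
    =1 onleft Phi \o onright tau \o onleft Phi.

Definition is_left_unit Phi a : Prop := forall b, Phi (a ⊗v b) = b ⊗v a.

Definition is_left_counit Phi eps : Prop :=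
  @tlunit K A \o (eps ⊗f Id) \o Phi =1 @trunit K A \o (Id ⊗f eps).

Definition is_assoc m : Prop :=
  m \o (m ⊗f Id) =1 m \o (Id ⊗f m) \o assoc.

Definition is_coassoc Delta : Prop :=
  assoc \o (Delta ⊗f Id) \o Delta =1 (Id ⊗f Delta) \o Delta.

(* The product of A ⊗ A induced by m: (x ⊗ y)(z ⊗ t) = xz ⊗ yt. *)
Definition tprod m : (A ⊗ A) ⊗ (A ⊗ A) -> A ⊗ A :=
  (m ⊗f m) \o @tassocV K A A (A ⊗ A) \o
  (Id ⊗f (assoc \o (tau ⊗f Id) \o assocV)) \o
  @tassoc K A A (A ⊗ A).

Lemma tprodE m x y z t :
  tprod m ((x ⊗v y) ⊗v (z ⊗v t)) = m (x ⊗v z) ⊗v m (y ⊗v t).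
Proof.
by rewrite /tprod /= tassocE tmapE /= tassocVE tmapE /= tflipE tassocE tassocVE tmapE.
Qed.

Record is_bialgebra m Delta : Prop := {
  bialg_assoc : is_assoc m;
  bialg_coassoc : is_coassoc Delta;
  bialg_mult : Delta \o m =1 tprod m \o (Delta ⊗f Delta)
}.

Definition is_prod_left_unit m a : Prop := forall b, m (a ⊗v b) = b.

Definition is_coprod_left_counit Delta eps : Prop :=
  @tlunit K A \o (eps ⊗f Id) \o Delta =1 id.

(* a ⊗ b |-> sum a1 ⊗ a2 ⊗ b |-> sum a1 ⊗ b ⊗ a2
   |-> sum a1 b ⊗ a2 *)
Definition lEAS_of m Delta : A ⊗ A -> A ⊗ A :=
  (m ⊗f Id) \o assocV \o onright tau \o
  assoc \o (Delta ⊗f Id).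

HB.instance Definition _ m Delta := GRing.Linear.copy (lEAS_of m Delta)
  ((m ⊗f Id) \o assocV \o onright tau \o
   assoc \o (Delta ⊗f Id)).

Definition coprod_of Phi a : A -> A ⊗ A := fun b => Phi (b ⊗v a).

Lemma coprod_of_linear Phi a : linear (coprod_of Phi a).
Proof. by move=> k x y; rewrite /coprod_of linearPl linearP. Qed.

HB.instance Definition _ Phi a := GRing.isLinear.Build K A (A ⊗ A) *:%R
  (coprod_of Phi a) (coprod_of_linear Phi a).

Definition prod_of Phi eps : A ⊗ A -> A :=
  @trunit K A \o (Id ⊗f eps) \o Phi.

HB.instance Definition _ Phi eps := GRing.Linear.copy (prod_of Phi eps)
  (@trunit K A \o (Id ⊗f eps) \o Phi).

End LinearEAS.

(* Main.v *)
Require Import Defs.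
From HB Require Import structures.
From mathcomp Require Import all_boot all_algebra.

Import GRing.Theory.
Local Open Scope ring_scope.

(** Evaluating the defining identity of an lEAS on [x ⊗ (y ⊗ z)], and writing
    [Δ_z = Phi (- ⊗ z)], turns it into the flip-free form [lEAS_pure]:
      [(Id ⊗ Phi) (Phi ⊗ Id) (x ⊗ Phi (y ⊗ z)) = (Δ_z ⊗ Id) (Phi (x ⊗ y))].
    Every assertion is a specialization of this identity, with some arguments
    set to [a] or some of the three output factors contracted by [eps].  Below,
    [m] is [Phi] followed by the contraction of the second factor, and
    [Δ = Δ_a].

    - Coassociativity: for [y = z = a] the inner [Phi] disappears.
    - Associativity: contract the last two factors.  The outer [Id ⊗ Phi] is
      absorbed because [eps ⊗ eps] is invariant, which leaves [x (y z)] on the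
      left and [(x y) z] on the right.
    - [Phi] is recovered from [m] and [Δ]: take [y = a] and contract the middle
      factor.  The unit turns [Phi (a ⊗ z)] into [z ⊗ a], the counit undoes the
      outer [Phi], and what remains is [Phi (x ⊗ z) = sum (x1 z) ⊗ x2].
    - Multiplicativity: take [z = a] and contract the last factor.  The right
      side becomes [Δ (x y)]; on the left, the previous formula for
      [Phi (x ⊗ y1)] produces [sum (x1 y1) ⊗ (x2 y2)], that is [Δ x Δ y].

    The first two items apply to a left unit [a] and a left counit [eps], since
    both are special of eigenvalue 1. *)

(** * Extensionality on tensor products *)

Section TensorExt.
Context {K : fieldType} {A B C M : lmodType K}.

Lemma tens_ext3r (f g : {linear A ⊗ (B ⊗ C) -> M}) :
  (forall x y z, f (x ⊗v (y ⊗v z)) = g (x ⊗v (y ⊗v z))) -> f =1 g.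
Proof.
move=> fg; apply: tens_ext => x.
by apply: (@tens_ext _ _ _ _ (f \o tpure x) (g \o tpure x)) => y z; exact: fg.
Qed.

Lemma tens_ext3l (f g : {linear (A ⊗ B) ⊗ C -> M}) :
  (forall x y z, f (x ⊗v y ⊗v z) = g (x ⊗v y ⊗v z)) -> f =1 g.
Proof.
move=> fg u; rewrite -[u]tassocK.
apply: (@tens_ext3r (f \o @tassocV K A B C) (g \o @tassocV K A B C)).
by move=> x y z /=; rewrite tassocVE.
Qed.

End TensorExt.

Lemma eq_tmap {K : fieldType} {A B C D : lmodType K}
    {f f' : {linear A -> C}} {g g' : {linear B -> D}} :
  f =1 f' -> g =1 g' -> f ⊗f g =1 f' ⊗f g'.
Proof.
move=> ff' gg'; apply: (tens_ext (f := f ⊗f g) (g := f' ⊗f g')) => x y.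
by rewrite /= !tmapE ff' gg'.
Qed.

(** * Contraction of one factor by a linear form *)

Section Contraction.
Context {K : fieldType} {A B : lmodType K}.

Definition contractr (eps : {linear B -> K^o}) : A ⊗ B -> A :=
  @trunit K A \o (@idfun A ⊗f eps).

Definition contractl (eps : {linear A -> K^o}) : A ⊗ B -> B :=
  @tlunit K B \o (eps ⊗f @idfun B).

HB.instance Definition _ eps := GRing.Linear.copy (contractr eps)
  (@trunit K A \o (@idfun A ⊗f eps)).
HB.instance Definition _ eps := GRing.Linear.copy (contractl eps)
  (@tlunit K B \o (eps ⊗f @idfun B)).

Lemma contractrE eps x y : contractr eps (x ⊗v y) = (eps y : K) *: x.
Proof. by rewrite /contractr /= tmapE trunitE. Qed.

Lemma contractlE eps x y : contractl eps (x ⊗v y) = (eps x : K) *: y.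
Proof. by rewrite /contractl /= tmapE /= tlunitE. Qed.

End Contraction.

(** * The lEAS identity on three factors and its contractions *)

Section ThreeFactors.
Context {K : fieldType} {A : lmodType K}.
Implicit Types (Phi : {linear A ⊗ A -> A ⊗ A}) (eps : {linear A -> K^o}).
Implicit Types (m : {linear A ⊗ A -> A}) (Delta : {linear A -> A ⊗ A}).

Local Notation Id := (@idfun A).
Local Notation assoc := (@tassoc K A A A).
Local Notation assocV := (@tassocV K A A A).
Local Notation tau := (@tflip K A A).

Lemma onleftE Phi x y z :
  onleft Phi (x ⊗v (y ⊗v z)) = assoc (Phi (x ⊗v y) ⊗v z).
Proof. by rewrite /onleft /= tassocVE tmapE. Qed.

Lemma onrightE Phi x u : onright Phi (x ⊗v u) = x ⊗v Phi u.
Proof. exact: tmapE. Qed.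

Lemma onright_tassoc Phi (u : A ⊗ A) a :
  onright Phi (assoc (u ⊗v a)) = (Id ⊗f coprod_of Phi a) u.
Proof.
apply: (@tens_ext _ _ _ _ (onright Phi \o assoc \o applyr tpure a)
          (Id ⊗f coprod_of Phi a)) => x y /=.
by rewrite tassocE onrightE tmapE.
Qed.

Lemma onright_flip_tassoc (x y z : A) :
  onright tau (assoc (x ⊗v y ⊗v z)) = x ⊗v (z ⊗v y).
Proof. by rewrite tassocE /onright tmapE /= tflipE. Qed.

Lemma onleft_flip_tassoc Phi (u : A ⊗ A) z :
  onleft Phi (onright tau (assoc (u ⊗v z)))
    = assoc ((coprod_of Phi z ⊗f Id) u).
Proof.
apply: (@tens_ext _ _ _ _
  (onleft Phi \o (Id ⊗f tau) \o assoc \o applyr tpure z)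
  (assoc \o (coprod_of Phi z ⊗f Id))) => x y /=.
by rewrite [(_ ⊗f tau) _]onright_flip_tassoc onleftE tmapE.
Qed.

Lemma lEAS_ofE m Delta x y :
  lEAS_of m Delta (x ⊗v y)
    = (m ⊗f Id) (assocV (onright tau (assoc (Delta x ⊗v y)))).
Proof. by rewrite /lEAS_of /= tmapE. Qed.

(** The form of the lEAS identity from which everything else is specialized:
    fixing the third tensor factor hides the flip inside [coprod_of]. *)
Lemma lEAS_pure Phi : is_lEAS Phi -> forall x y z : A,
  onright Phi (onleft Phi (x ⊗v Phi (y ⊗v z)))
    = assoc ((coprod_of Phi z ⊗f Id) (Phi (x ⊗v y))).
Proof.
move=> hPhi x y z; rewrite -onrightE -onleft_flip_tassoc -onleftE.
exact: (hPhi (x ⊗v (y ⊗v z))).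
Qed.

Lemma contractr_tassoc eps (w : A ⊗ A) y :
  (Id ⊗f contractr eps) (assoc (w ⊗v y)) = (eps y : K) *: w.
Proof.
apply: (@tens_ext _ _ _ _
  ((Id ⊗f contractr eps) \o assoc \o applyr tpure y)
  ((eps y : K) \*: @idfun (A ⊗ A))) => p q /=.
by rewrite tassocE tmapE /= contractrE linearZ.
Qed.

Lemma contractl_tassoc eps (w : A ⊗ A) y :
  (Id ⊗f contractl eps) (assoc (w ⊗v y)) = contractr eps w ⊗v y.
Proof.
apply: (@tens_ext _ _ _ _
  ((Id ⊗f contractl eps) \o assoc \o applyr tpure y)
  (applyr tpure y \o contractr eps)) => p q /=.
by rewrite tassocE tmapE /= contractlE contractrE linearZ linearZl_LR.
Qed.

(** The invariance of [eps ⊗ eps] needs the last two factors contracted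
    together, while [Phi ⊗ Id] and [Id ⊗ Phi] only interact well with
    contractions of a single factor. *)
Lemma contract2E eps (t : A ⊗ (A ⊗ A)) :
  contractr (@tlunit K K^o \o (eps ⊗f eps)) t
    = contractr eps ((Id ⊗f contractr eps) t).
Proof.
apply: (tens_ext3r (contractr (@tlunit K K^o \o (eps ⊗f eps)))
  (contractr eps \o (Id ⊗f contractr eps))) => x y z /=.
rewrite contractrE /= !tmapE /= tlunitE !contractrE.
by rewrite linearZ_LR; congr (_ *: _); exact: mulrC.
Qed.

Lemma contractr_onleft Phi eps (t : A ⊗ (A ⊗ A)) :
  (Id ⊗f contractr eps) (onleft Phi t) = Phi ((Id ⊗f contractr eps) t).
Proof.
apply: (tens_ext3r ((Id ⊗f contractr eps) \o onleft Phi)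
  (Phi \o (Id ⊗f contractr eps))) => x y z /=.
by rewrite onleftE contractr_tassoc tmapE /= contractrE !linearZ.
Qed.

Lemma tmap_onright (B : lmodType K) (g : {linear A ⊗ A -> B}) Phi
    (t : A ⊗ (A ⊗ A)) :
  (Id ⊗f g) (onright Phi t) = (Id ⊗f (g \o Phi)) t.
Proof.
apply: (@tens_ext _ _ _ _ ((Id ⊗f g) \o onright Phi) (Id ⊗f (g \o Phi))).
by move=> x u /=; rewrite onrightE !tmapE.
Qed.

Lemma contractr_tmap Delta eps (u : A ⊗ A) :
  (Id ⊗f contractr eps) (assoc ((Delta ⊗f Id) u)) = Delta (contractr eps u).
Proof.
apply: (@tens_ext _ _ _ _
  ((Id ⊗f contractr eps) \o assoc \o (Delta ⊗f Id))
  (Delta \o contractr eps)) => p q /=.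
by rewrite tmapE /= contractr_tassoc contractrE linearZ.
Qed.

Lemma contractl_coprod Phi eps z (u : A ⊗ A) :
  (Id ⊗f contractl eps) (assoc ((coprod_of Phi z ⊗f Id) u))
    = (prod_of Phi eps ⊗f Id) (assocV (onright tau (assoc (u ⊗v z)))).
Proof.
apply: (@tens_ext _ _ _ _
  ((Id ⊗f contractl eps) \o assoc \o (coprod_of Phi z ⊗f Id))
  ((prod_of Phi eps ⊗f Id) \o assocV \o (Id ⊗f tau) \o assoc
     \o applyr tpure z)) => p q /=.
rewrite [(_ ⊗f tau) _]onright_flip_tassoc tassocVE !tmapE.
exact: contractl_tassoc.
Qed.

HB.instance Definition _ m := GRing.Linear.copy (tprod m)
  ((m ⊗f m) \o @tassocV K A A (A ⊗ A) \o
   (Id ⊗f (assoc \o (tau ⊗f Id) \o assocV)) \o @tassoc K A A (A ⊗ A)).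

(** Rebuilding the product of [A ⊗ A] from the map [Phi] attached to a
    bialgebra: one application of [Phi] multiplies the first factors and
    carries [x2] past [y1], next to the [y2] it has to multiply. *)
Lemma tprod_lEAS_of m Delta x (v : A ⊗ A) :
  (Id ⊗f m) (onleft (lEAS_of m Delta) (x ⊗v v)) = tprod m (Delta x ⊗v v).
Proof.
apply: (@tens_ext _ _ _ _
  ((Id ⊗f m) \o onleft (lEAS_of m Delta) \o tpure x)
  (tprod m \o tpure (Delta x))) => y z /=.
rewrite onleftE /= lEAS_ofE.
apply: (@tens_ext _ _ _ _
  ((Id ⊗f m) \o assoc \o applyr tpure z \o (m ⊗f Id) \o assocV \o
     (Id ⊗f tau) \o assoc \o applyr tpure y)
  (tprod m \o applyr tpure (y ⊗v z))) => p q /=.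
rewrite [(_ ⊗f tau) _]onright_flip_tassoc tassocVE !tmapE /= tassocE.
by rewrite tmapE tprodE.
Qed.

End ThreeFactors.

(** * Product and coproduct extracted from an lEAS *)

Section Specializations.
Context {K : fieldType} {A : lmodType K} (Phi : {linear A ⊗ A -> A ⊗ A}).
Hypothesis hPhi : is_lEAS Phi.
Implicit Types (a : A) (eps : {linear A -> K^o}).

Local Notation Id := (@idfun A).

Lemma coprod_of_coassoc a :
  Phi (a ⊗v a) = a ⊗v a -> is_coassoc (coprod_of Phi a).
Proof.
move=> aa b; have := lEAS_pure Phi hPhi b a a.
by rewrite aa onleftE onright_tassoc => /esym.
Qed.

Lemma prod_of_assoc eps :
  (eps ⊗f eps) \o Phi =1 eps ⊗f eps -> is_assoc (prod_of Phi eps).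
Proof.
move=> ee.
pose eps2 : {linear A ⊗ A -> K^o} := @tlunit K K^o \o (eps ⊗f eps).
have e2Phi (t : A ⊗ (A ⊗ A)) :
    contractr eps2 (onright Phi t) = contractr eps2 t.
  rewrite /contractr /= tmap_onright; congr (trunit _).
  apply: (eq_tmap (f := Id) (g := eps2 \o Phi) (g' := eps2)) => // u /=.
  by congr (tlunit _); exact: ee.
apply: (tens_ext3l (prod_of Phi eps \o (prod_of Phi eps ⊗f Id))
  (prod_of Phi eps \o (Id ⊗f prod_of Phi eps) \o @tassoc K A A A)) => x y z /=.
rewrite tassocE !tmapE /=.
(* Contracting the last two factors removes the outer [Id ⊗ Phi]. *)
have /(congr1 (contractr eps2)) := lEAS_pure Phi hPhi x y z.
rewrite e2Phi !contract2E contractr_onleft contractr_tmap tmapE.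
by move=> /esym.
Qed.

Section Unital.
Variables (a : A) (eps : {linear A -> K^o}).
Hypotheses (ua : is_left_unit Phi a) (ue : is_left_counit Phi eps).
Hypothesis ea : eps a = 1.

Local Notation m := (prod_of Phi eps).
Local Notation Delta := (coprod_of Phi a).

Lemma contractl_counit (u : A ⊗ A) :
  contractl eps (Phi u) = contractr eps u.
Proof. exact: ue. Qed.

(** [eps ⊗ eps] factors through [eps] after contracting either factor, and
    the counit axiom says that [Phi] turns the left contraction into the right
    one. *)
Lemma left_counit_special : (eps ⊗f eps) \o Phi =1 eps ⊗f eps.
Proof.
have el u : @tlunit K K^o ((eps ⊗f eps) u) = eps (contractl eps u).
  apply: (@tens_ext _ _ _ _ (@tlunit K K^o \o (eps ⊗f eps))
    (eps \o contractl eps)) => x y /=.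
  by rewrite tmapE tlunitE contractlE linearZ.
have er u : @tlunit K K^o ((eps ⊗f eps) u) = eps (contractr eps u).
  apply: (@tens_ext _ _ _ _ (@tlunit K K^o \o (eps ⊗f eps))
    (eps \o contractr eps)) => x y /=.
  by rewrite tmapE tlunitE contractrE linearZ; exact: mulrC.
(* The two forms are compared with values in [K ⊗ K], which is [K]. *)
have tlK : cancel (@tlunit K K^o) (tpure (1 : K^o)).
  apply: (@tens_ext _ _ _ _ (tpure (1 : K^o) \o @tlunit K K^o) idfun) => x y /=.
  rewrite tlunitE linearZ -[x in RHS]mulr1.
  rewrite [x * _](_ : _ = (x : K) *: (1 : K^o)) //.
  by rewrite linearZl_LR.
by move=> u; apply: (can_inj tlK); rewrite /= el contractl_counit er.
Qed.

Lemma prod_of_left_unit : is_prod_left_unit m a.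
Proof.
move=> b; rewrite -[LHS]/(contractr eps (Phi (a ⊗v b))) ua contractrE ea.
exact: scale1r.
Qed.

Lemma coprod_of_left_counit : is_coprod_left_counit Delta eps.
Proof.
move=> b; have := contractl_counit (b ⊗v a).
by rewrite contractrE ea scale1r.
Qed.

(** In [lEAS_pure] at [(x, a, z)] the unit makes the left side
    [(Id ⊗ Phi) (Phi (x ⊗ z) ⊗ a)]; contracting the middle factor then leaves
    [Phi (x ⊗ z)] because [eps a = 1]. *)
Lemma lEAS_prod_coprod : Phi =1 lEAS_of m Delta.
Proof.
apply: tens_ext => x z.
have /(congr1 (Id ⊗f contractl eps)) := lEAS_pure Phi hPhi x a z.
rewrite ua onleftE contractl_coprod tmap_onright.
rewrite (eq_tmap (f := Id) (f' := Id) (g := contractl eps \o Phi)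
  (g' := contractr eps) _ contractl_counit) //.
by rewrite contractr_tassoc ea scale1r => ->; rewrite /= lEAS_ofE.
Qed.

(** Contracting the last factor of [lEAS_pure] at [(x, y, a)] merges the
    legs of [Delta x] and [Delta y]; [tprod_lEAS_of] recognizes the outcome as
    their product once [Phi] is replaced by [lEAS_of m Delta]. *)
Lemma coprod_of_mult : Delta \o m =1 tprod m \o (Delta ⊗f Delta).
Proof.
apply: (tens_ext (f := Delta \o m)
  (g := tprod m \o (Delta ⊗f Delta))) => x y /=.
have /(congr1 (Id ⊗f contractr eps)) := lEAS_pure Phi hPhi x y a.
rewrite contractr_tmap tmap_onright tmapE /= -tprod_lEAS_of => <-.
congr (tmap _ _ _); rewrite /onleft /=; congr (tassoc _).
exact: (eq_tmap (g := Id) lEAS_prod_coprod).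
Qed.

End Unital.

End Specializations.

Theorem theorem5p16 (K : fieldType) (A : lmodType K)
    (Phi : {linear A ⊗ A -> A ⊗ A}) (hPhi : is_lEAS Phi) :
  (forall a : A,
     Phi (a ⊗v a) = a ⊗v a -> is_coassoc (coprod_of Phi a))
  /\
  (forall eps : {linear A -> K^o},
     (eps ⊗f eps) \o Phi =1 eps ⊗f eps -> is_assoc (prod_of Phi eps))
  /\
  (forall (a : A) (eps : {linear A -> K^o}),
     is_left_unit Phi a -> is_left_counit Phi eps -> eps a = 1 ->
     [/\ is_bialgebra (prod_of Phi eps) (coprod_of Phi a),
         is_prod_left_unit (prod_of Phi eps) a,
         is_coprod_left_counit (coprod_of Phi a) eps
       & Phi =1 lEAS_of (prod_of Phi eps) (coprod_of Phi a)]).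
Proof.
split; first exact: coprod_of_coassoc.
split; first exact: prod_of_assoc.
move=> a eps ua ue ea; split.
- split; last exact: coprod_of_mult.
  + exact/prod_of_assoc/left_counit_special.
  + exact/coprod_of_coassoc/ua.
- exact: prod_of_left_unit.
- exact: coprod_of_left_counit.
- exact: lEAS_prod_coprod.
Qed.
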